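(* The Poisson center of $H_\zeta'(\mathfrak{gl}_n)$ is the polynomial algebra $\mathbb{C}[\tau_1+c_1,\tau_2+c_2,\dots,\tau_n+c_n]$, where for $1\le i\le n$, $(-1)^ic_i$ is the coefficient of $t^i$ in the series \[ c(t)=\mathrm{Res}_{z=0}\,\zeta(z^{-1})\frac{\det(1-tA)}{\det(1-zA)}\frac{1}{1-t^{-1}z}\frac{dz}{z}. \]
   Context: Fix $n\ge1$; $e_{ij}$ matrix units of $\mathfrak{gl}_n$; $V$ with basis $y_1,\dots,y_n$, $e_{ij}y_k=\delta_{jk}y_i$; $V^*$ dual with dual basis $x_1,\dots,x_n$. Identify $S(\mathfrak{gl}_n)$ with polynomial functions of a matrix $A\in\mathfrak{gl}_n$ via the trace form. For $j\ge0$ let $\mathfrak{r}_j(y,x)\in S(\mathfrak{gl}_n)$ be the coefficient of $\tau^j$ in $(x,(1-\tau A)^{-1}y)\det(1-\tau A)^{-1}$. For $\zeta_0,\dots,\zeta_k\in\mathbb{C}$, let $\zeta(z)=\zeta_0+\zeta_1z+\dots+\zeta_kz^k$ and let $H_\zeta'(\mathfrak{gl}_n)$ be the commutative algebra $S(\mathfrak{gl}_n)\otimes S(V\oplus V^* )$ with the Poisson bracket determined on generators by $\{a,b\}=[a,b]$ for $a,b\in\mathfrak{gl}_n$, $\{g,u\}=g(u)$ for $g\in\mathfrak{gl}_n$, $u\in V\oplus V^*$, $\{y,y'\}=\{x,x'\}=0$, and $\{y,x\}=\sum_j\zeta_j\mathfrak{r}_j(y,x)$ for $y,y'\in V$, $x,x'\in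 V^*$ (this is a Poisson bracket). Let $\mathcal{Q}_k\in S(\mathfrak{gl}_n)$ be the coefficient of $(-t)^k$ in $\det(1-tA)$, and $\tau_k=\sum_{i=1}^nx_i\{\mathcal{Q}_k,y_i\}$. In $c(t)$, $1/(1-t^{-1}z)$ is expanded as $\sum_{l\ge0}z^lt^{-l}$ and $\det(1-zA)^{-1}$ as a power series in $z$. *)

(* Defs.v *)
From HB Require Import structures.
From mathcomp Require Import all_boot all_order all_algebra.
From mathcomp Require Import mpoly.
From mathcomp Require Import reals complex.
Set Implicit Arguments. Unset Strict Implicit. Unset Printing Implicit Defensive.
Import Order.TTheory GRing.Theory Num.Theory.
Local Open Scope ring_scope.

(* Variables of H'_zeta(gl_n) = S(gl_n) (x) S(V + V^* ):
   n*n matrix units e_ij, then y_1..y_n, then x_1..x_n. *)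
Definition nvars (n : nat) : nat := (n * n + n + n)%N.
Definition HH (K : fieldType) (n : nat) := {mpoly K[nvars n]}.

Definition idxE n (i j : 'I_n) : 'I_(nvars n) := lshift n (lshift n (mxvec_index i j)).
Definition idxY n (i : 'I_n) : 'I_(nvars n) := lshift n (rshift (n * n) i).
Definition idxX n (i : 'I_n) : 'I_(nvars n) := rshift (n * n + n) i.

Section H.
Variables (K : fieldType) (n : nat).
Local Notation H := (HH K n).

Definition eX (i j : 'I_n) : H := 'X_(idxE i j).
Definition yX (i : 'I_n) : H := 'X_(idxY i).
Definition xX (i : 'I_n) : H := 'X_(idxX i).

(* The generic matrix A, identified with S(gl_n) via the trace form:
   the function A |-> A_ij = tr(e_ji A) is the element e_ji. *)
Definition Amat : 'M[H]_n := \matrix_(i, j) eX j i.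

Definition detp : {poly H} := \det (1%:M - 'X *: map_mx polyC Amat).

(* coefficient of tau^p in the power series det(1 - tau A)^{-1}
   (using 1/g = sum_k (1-g)^k, valid since g(0) = 1). *)
Definition hcoef (p : nat) : H := (\sum_(k < p.+1) (1 - detp) ^+ k)`_p.

(* r_j(y_i, x_l) = coefficient of tau^j in (x_l,(1-tau A)^{-1} y_i) det(1-tau A)^{-1},
   where (x_l, A^m y_i) = (A^m)_{l i}. *)
Definition rcoef (j : nat) (i l : 'I_n) : H :=
  \sum_(m < j.+1) (Amat ^+ m) l i * hcoef (j - m).

Variable zeta : {poly K}.

Definition brYX (i l : 'I_n) : H :=
  \sum_(j < size zeta) (zeta`_j)%:MP * rcoef j i l.

Local Notation d a f := (mderiv a f).

(* The Poisson bracket: the unique biderivation extending the given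
   brackets on generators:
   {e_ij, e_kl} = [e_ij, e_kl] = delta_jk e_il - delta_li e_kj,
   {e_ij, y_k} = e_ij y_k = delta_jk y_i,
   {e_ij, x_k} = e_ij . x_k = - delta_ik x_j   (dual action),
   {y, y'} = {x, x'} = 0, {y_i, x_l} = brYX i l. *)
Definition pb (f g : H) : H :=
  \sum_(i < n) \sum_(j < n) \sum_(k < n) \sum_(l < n)
     d (idxE i j) f * d (idxE k l) g *
       ((j == k)%:R * eX i l - (l == i)%:R * eX k j)
  + \sum_(i < n) \sum_(j < n) \sum_(k < n)
     (d (idxE i j) f * d (idxY k) g - d (idxY k) f * d (idxE i j) g) *
       ((j == k)%:R * yX i)
  + \sum_(i < n) \sum_(j < n) \sum_(k < n)
     (d (idxE i j) f * d (idxX k) g - d (idxX k) f * d (idxE i j) g) *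
       (- ((i == k)%:R * xX j))
  + \sum_(i < n) \sum_(l < n)
     (d (idxY i) f * d (idxX l) g - d (idxX l) f * d (idxY i) g) * brYX i l.

Definition poisson_central (f : H) : Prop := forall g : H, pb f g = 0.

Definition Qk (k : nat) : H := (-1) ^+ k * detp`_k.

Definition tauk (k : nat) : H := \sum_(i < n) xX i * pb (Qk k) (yX i).

(* c(t) = Res_{z=0} zeta(z^{-1}) det(1-tA)/det(1-zA) 1/(1-t^{-1}z) dz/z.
   Expanding zeta(z^{-1}) = sum_j zeta_j z^{-j}, det(1-zA)^{-1} = sum_p h_p z^p,
   1/(1-t^{-1}z) = sum_l z^l t^{-l}, det(1-tA) = sum_q detp_q t^q,
   the residue (coefficient of z^0 of the integrand without dz/z) picks
   p + l = j, and the coefficient of t^i picks q = i + l. *)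
Definition ccoef_t (i : nat) : H :=
  \sum_(j < size zeta) (zeta`_j)%:MP *
     \sum_(l < j.+1) hcoef (j - l) * detp`_(i + l).

Definition ck (i : nat) : H := (-1) ^+ i * ccoef_t i.

Definition centerGen (i : 'I_n) : H := tauk i.+1 + ck i.+1.

Definition evalGen (P : {mpoly K[n]}) : H := mmap (@mpolyC _ K) centerGen P.

End H.

(* Main.v *)
Require Import Defs.
From HB Require Import structures.
From mathcomp Require Import all_boot all_order all_algebra.
From mathcomp Require Import mpoly.
From mathcomp Require Import reals complex.
From mathcomp Require Import ring.
Set Implicit Arguments. Unset Strict Implicit. Unset Printing Implicit Defensive.
Import GRing.Theory.
Local Open Scope ring_scope.

(* Let Phi_q be the coefficients of adj(1 - tA) and B_j those of
   (1 - tA)^-1 / det(1 - tA), so that {y, x} is given by b = sum_j zeta_j B_j and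
   tau_(q+1) = (-1)^q y Phi_q x.  Any derivation D satisfies
   D det(1 - tA)_(q+1) = - tr (Phi_q DA), D h_(p+1) = tr (B_p DA), and a resolvent
   identity between Phi and B turns these into D c(t)_(q+1) = - tr (Phi_q b DA).
   For D = {-, x_k} and D = {-, y_k} the matrix DA has rank one and this cancels
   D tau_(q+1); for D = {-, e_kl} it is a commutator.  So the tau_i + c_i are central.

   Conversely, restrict to the affine slice where A = N is the nilpotent shift, x is the
   cyclic vector e_0 and y is arbitrary: there c_i vanishes and tau_(i+1) + c_(i+1) is
   the coordinate (-1)^i y_i.  Hence the generators are algebraically independent, and
   every central f differs from a polynomial in them by a central g vanishing on the
   slice.  The Hamiltonian vector fields of e_kl and x_k are transversal to the slice
   and kill g, so by induction on the order all partial derivatives of g vanish on the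
   slice, whence g = 0 in characteristic 0. *)

(** * Derivations and their action on determinants and matrices *)

Definition derivation (R : nzRingType) (D : R -> R) : Prop :=
  (forall f g, D (f + g) = D f + D g)
  /\ (forall f g, D (f * g) = D f * g + f * D g).

Section Derivation.
Variables (R : comNzRingType) (D : R -> R).
Hypothesis derD : derivation D.

Lemma der_add f g : D (f + g) = D f + D g. Proof. by case: derD. Qed.
Lemma der_mul f g : D (f * g) = D f * g + f * D g. Proof. by case: derD. Qed.

Lemma der0 : D 0 = 0.
Proof. by apply: (addrI (D 0)); rewrite -der_add !addr0. Qed.

Lemma der1 : D 1 = 0.
Proof. by apply: (addrI (D 1)); rewrite addr0 -[in RHS](mulr1 1) der_mul mulr1 mul1r. Qed.

Lemma der_opp f : D (- f) = - D f.
Proof. by apply: (addrI (D f)); rewrite -der_add !subrr der0. Qed.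

Lemma der_sub f g : D (f - g) = D f - D g.
Proof. by rewrite der_add der_opp. Qed.

Lemma der_natr k : D k%:R = 0.
Proof. by elim: k => [|k IHk]; rewrite ?der0 // mulrSr der_add IHk der1 addr0. Qed.

Lemma der_signr k : D ((-1) ^+ k) = 0.
Proof. by rewrite -signr_odd; case: (odd k); rewrite ?expr1 ?expr0 ?der_opp der1 ?oppr0. Qed.

Lemma der_sum I (r : seq I) (P : pred I) F :
  D (\sum_(i <- r | P i) F i) = \sum_(i <- r | P i) D (F i).
Proof. exact: (big_morph D der_add der0). Qed.

Lemma der_prod m (F : 'I_m -> R) :
  D (\prod_i F i) = \sum_i \prod_j (if j == i then D (F j) else F j).
Proof.
elim: m F => [|m IHm] F; first by rewrite !big_ord0 der1.
rewrite big_ord_recl der_mul IHm [RHS]big_ord_recl; congr (_ + _).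
  by rewrite [RHS]big_ord_recl eqxx.
rewrite mulr_sumr; apply: eq_bigr => i _; rewrite [RHS]big_ord_recl /=.
congr (_ * _); apply: eq_bigr => j _; by rewrite (inj_eq lift_inj).
Qed.

(** Jacobi's formula: the product rule on the Leibniz expansion differentiates one row at a time,
    and expanding along that row produces the cofactors. *)
Lemma der_det m (M : 'M[R]_m) : D (\det M) = \tr (\adj M *m map_mx D M).
Proof.
pose N i := \matrix_(k, l) (if k == i then D (M k l) else M k l).
transitivity (\sum_i \det (N i)).
  rewrite /determinant der_sum exchange_big /=; apply: eq_bigr => s _.
  rewrite der_mul der_signr mul0r add0r der_prod mulr_sumr.
  apply: eq_bigr => i _; congr (_ * _); apply: eq_bigr => j _.
  by rewrite mxE.
rewrite mxtrace_mulC /mxtrace; apply: eq_bigr => i _.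
rewrite (expand_det_row _ i) mxE; apply: eq_bigr => j _.
rewrite !mxE eqxx; congr (_ * (_ * \det _)).
by apply/matrixP => k l; rewrite !mxE eq_sym (negPf (neq_lift i k)).
Qed.

Lemma der_mulmx m p q (M : 'M[R]_(m, p)) (N : 'M[R]_(p, q)) :
  map_mx D (M *m N) = map_mx D M *m N + M *m map_mx D N.
Proof.
apply/matrixP => i j; rewrite !mxE der_sum -big_split; apply: eq_bigr => k _.
by rewrite der_mul !mxE.
Qed.

Lemma der_addmx m p (M N : 'M[R]_(m, p)) :
  map_mx D (M + N) = map_mx D M + map_mx D N.
Proof. by apply/matrixP => i j; rewrite !mxE der_add. Qed.

Lemma der_scalemx m p c (M : 'M[R]_(m, p)) :
  map_mx D (c *: M) = D c *: M + c *: map_mx D M.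
Proof. by apply/matrixP => i j; rewrite !mxE der_mul. Qed.

Lemma der_mx1 m : map_mx D (1%:M : 'M[R]_m) = 0.
Proof. by apply/matrixP => i j; rewrite !mxE der_natr. Qed.

(** Allows [der_det] to be applied to 1 - tA over the polynomial ring. *)
Lemma derivation_map_poly : derivation (map_poly D : {poly R} -> {poly R}).
Proof.
have cf (p : {poly R}) i : (map_poly D p)`_i = D p`_i.
  by rewrite coef_map_id0 // der0.
split=> f g; apply/polyP => i; first by rewrite !(cf, coefD) der_add.
rewrite cf coefD !coefM der_sum -big_split; apply: eq_bigr => k _.
by rewrite der_mul !cf.
Qed.

End Derivation.

Section DerivationClosure.
Variable R : comNzRingType.
Implicit Types D E : R -> R.

Lemma derivation_sum I (r : seq I) (D : I -> R -> R) :
  (forall i, derivation (D i)) -> derivation (fun f => \sum_(i <- r) D i f).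
Proof.
move=> dD; split=> f g.
  by rewrite -big_split; apply: eq_bigr => i _; rewrite (der_add (dD i)).
rewrite mulr_suml mulr_sumr -big_split; apply: eq_bigr => i _.
exact: (der_mul (dD i)).
Qed.

Lemma derivation_scale c D : derivation D -> derivation (fun f => D f * c).
Proof.
move=> dD; split=> f g; first by rewrite (der_add dD) mulrDl.
by rewrite (der_mul dD); ring.
Qed.

Lemma derivation_add D E :
  derivation D -> derivation E -> derivation (fun f => D f + E f).
Proof.
move=> dD dE; split=> f g; first by rewrite (der_add dD) (der_add dE) addrACA.
by rewrite (der_mul dD) (der_mul dE); ring.
Qed.

Lemma derivation_opp D : derivation D -> derivation (fun f => - D f).
Proof.
move=> dD; split=> f g; first by rewrite (der_add dD) opprD.
by rewrite (der_mul dD); ring.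
Qed.

End DerivationClosure.

(* The coefficient of t^q in (sum_p a_p t^p) (1 - tA)^-1. *)
Definition mxconv (R : comNzRingType) n (A : 'M[R]_n) (a : nat -> R) q : 'M[R]_n :=
  \sum_(m < q.+1) a (q - m)%N *: A ^+ m.

(** * Recursions and products for coefficients of resolvents *)

Section Mxconv.
Variables (R : comNzRingType) (n : nat) (A : 'M[R]_n).
Implicit Types a h : nat -> R.
Local Notation "a '^#' q" := (mxconv A a q) (at level 8).

Lemma mxconv0 a : a^#0 = a 0 *: 1%:M.
Proof. by rewrite /mxconv big_ord1 expr0. Qed.

Lemma mxconvS a q : a^#(q.+1) = A * a^#q + a q.+1 *: 1%:M.
Proof.
rewrite /mxconv big_ord_recl addrC expr0 subn0; congr (_ + _).
rewrite mulr_sumr; apply: eq_bigr => i _.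
by rewrite exprS -mulmxE -scalemxAr.
Qed.

Lemma mxconv_comm a q M : A * M = M * A -> a^#q * M = M * a^#q.
Proof.
move=> cAM; rewrite /mxconv mulr_suml mulr_sumr; apply: eq_bigr => i _.
have -> : a (q - i)%N *: A ^+ i * M = a (q - i)%N *: (A ^+ i * M).
  by rewrite -!mulmxE scalemxAl.
have -> : M * (a (q - i)%N *: A ^+ i) = a (q - i)%N *: (M * A ^+ i).
  by rewrite -!mulmxE scalemxAr.
by congr (_ *: _); apply/commr_sym/commrX/commr_sym.
Qed.

Lemma mxconvSr a q : a^#(q.+1) = a^#q * A + a q.+1 *: 1%:M.
Proof. by rewrite mxconvS (mxconv_comm a q (erefl (A * A))). Qed.

(* Coefficient form of (t - z) (1 - tA)^-1 (1 - zA)^-1 = t (1 - tA)^-1 - z (1 - zA)^-1. *)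
Lemma mxconvM a h m j :
  a^#m * h^#j = \sum_(l < j.+1) h (j - l)%N *: a^#(m + l)
                - \sum_(l < j) a (m + l).+1 *: h^#(j - l.+1).
Proof.
elim: j m => [|j IHj] m.
  by rewrite big_ord1 big_ord0 subr0 addn0 mxconv0 -mulmxE -scalemxAr mulmx1.
(* Moves one unit of the index from [h] to [a], by the left recursion for [h] and the right one for
   [a]. *)
have -> : a^#m * h^#(j.+1) = a^#(m.+1) * h^#j - a m.+1 *: h^#j + h j.+1 *: a^#m.
  rewrite mxconvS mulrDr mulrA mxconvSr mulrDl -!mulmxE -!scalemxAl -!scalemxAr.
  by rewrite mul1mx mulmx1 addrK.
rewrite IHj [in RHS]big_ord_recl [X in _ = _ - X]big_ord_recl.
rewrite !addn0 subn0 subn1 opprD.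
under [X in _ = _ + X + _]eq_bigr => l _ do rewrite /= /bump /= add1n subSS addnS -addSn.
under [X in _ = _ + (_ - X)]eq_bigr => l _ do rewrite /= /bump /= add1n subSS addnS -addSn.
by rewrite [LHS]addrC -!addrA; congr (_ + (_ + _)); rewrite addrC.
Qed.

End Mxconv.

(** * Coefficients of det(1 - tA), its adjugate and its inverse, and their derivatives *)

Lemma coef_exp_lt (R : nzRingType) (f : {poly R}) k q :
  f`_0 = 0 -> (q < k)%N -> (f ^+ k)`_q = 0.
Proof.
move=> f0; elim: k q => [|k IHk] q // ltqk.
rewrite exprS coefM big1 // => -[[|i] lti] _ /=; first by rewrite f0 mul0r.
rewrite IHk ?mulr0 // ltn_subLR // addSn ltnS.
by rewrite ltnS in ltqk; apply: leq_trans ltqk (leq_addl _ _).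
Qed.

Lemma mxtrace_lincomb (R : comNzRingType) n k (c : 'I_k -> R) (F : 'I_k -> 'M[R]_n) X :
  \tr ((\sum_l c l *: F l) *m X) = \sum_l c l * \tr (F l *m X).
Proof.
rewrite mulmx_suml raddf_sum; apply: eq_bigr => l _.
by rewrite -scalemxAl /= mxtraceZ.
Qed.

Definition revdet (R : comNzRingType) n (A : 'M[R]_n) : {poly R} :=
  \det (1%:M - 'X *: map_mx polyC A).

(* Coefficients of the power series 1 / g, for g with constant term 1. *)
Definition inv_coef (R : comNzRingType) (g : {poly R}) p :=
  (\sum_(k < p.+1) (1 - g) ^+ k)`_p.

Section RevDet.
Variables (R : comNzRingType) (n : nat) (A : 'M[R]_n).

Local Notation M := (1%:M - 'X *: map_mx polyC A).
Local Notation g := (revdet A).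
Local Notation a q := (g`_q).
Local Notation h := (inv_coef g).
Local Notation Phi := (mxconv A (fun q => g`_q)).
Local Notation B := (mxconv A (inv_coef g)).

(** Comparing coefficients in adj(1 - tA) (1 - tA) = det(1 - tA) gives the recursion [mxconvSr]. *)
Lemma coef_adj_revdet q : map_mx (fun p : {poly R} => p`_q) (\adj M) = Phi q.
Proof.
have E : \adj M = g%:M + 'X *: (\adj M *m map_mx polyC A).
  by rewrite -mul_adj_mx mulmxBr mulmx1 -scalemxAr subrK.
elim: q => [|q IHq].
  rewrite mxconv0; apply/matrixP => i j; rewrite mxE E 2!mxE.
  by rewrite mxE coefD coefXM addr0 coefMn !mxE mulr_natr.
rewrite mxconvSr -IHq; apply/matrixP => i j.
rewrite mxE {1}E 3!mxE coefD coefXM coefMn /= addrC -mulmxE !mxE mulr_natr.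
congr (_ + _); rewrite coef_sum; apply: eq_bigr => l _.
by rewrite !mxE coefMC.
Qed.

Lemma coef0_revdet : a 0 = 1.
Proof.
rewrite -horner_coef0 -horner_evalE -det_map_mx -[RHS](det1 _ n).
congr (\det _); apply/matrixP => i j.
rewrite !mxE. by rewrite /= horner_evalE !hornerE subr0 -polyC_natr hornerC.
Qed.

Lemma revdet_conv p : \sum_(q < p.+2) a q * h (p.+1 - q) = 0.
Proof.
have w0 : (1 - g)`_0 = 0 by rewrite coefB coef1 coef0_revdet subrr.
(* All truncations of the geometric series beyond degree q agree in degree q, since 1 - g has no
   constant term. *)
have hE N q : (q < N)%N -> (\sum_(k < N) (1 - g) ^+ k)`_q = h q.
  move=> ltqN; rewrite /inv_coef !coef_sum [RHS](big_ord_widen N (fun k => ((1 - g) ^+ k)`_q)) //.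
  rewrite [LHS](bigID (fun k : 'I_N => (k < q.+1)%N)) /=.
  by rewrite [X in _ + X]big1 ?addr0 // => k; rewrite -leqNgt => /(coef_exp_lt w0).
(* Telescoping with p + 2 terms: the leftover power (1 - g)^(p+2) has no coefficient in degree p +
   1. *)
have /(congr1 (fun f : {poly R} => f`_p.+1)) := subrX1 (1 - g) p.+2.
rewrite coefB coef_exp_lt // coef1 subr0 addrAC subrr sub0r mulNr coefN coefM.
move/eqP; rewrite eq_sym oppr_eq0 => /eqP E; rewrite -[RHS]E; apply: eq_bigr => q _.
by rewrite hE // ltnS leq_subr.
Qed.

Variable D : R -> R.
Hypothesis derD : derivation D.

(** Jacobi's formula with D extended coefficientwise: 1 - tA has derivative -t DA, and the factor t
    accounts for the index shift. *)
Lemma der_coef_revdet q : D (a q.+1) = - \tr (Phi q *m map_mx D A).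
Proof.
have dP := derivation_map_poly derD.
have -> : D (a q.+1) = (map_poly D g)`_q.+1 by rewrite coef_map_id0 // der0.
rewrite (der_det dP).
have DC c : map_poly D c%:P = (D c)%:P.
  apply/polyP => k; rewrite coef_map_id0 ?der0 // !coefC.
  by case: (k == 0)%N; rewrite ?der0.
have -> : map_mx (map_poly D) M = - ('X *: map_mx polyC (map_mx D A)).
  apply/matrixP => i j; rewrite !mxE (der_sub dP) (der_natr dP) sub0r (der_mul dP).
  congr (- _); rewrite DC -[RHS]add0r; congr (_ + _).
  rewrite [X in X * _](_ : _ = 0) ?mul0r //.
  apply/polyP => k; rewrite coef_map_id0 ?der0 // coefX coef0.
  exact: der_natr.
rewrite mulmxN -scalemxAr raddfN /= mxtraceZ coefN coefXM /=; congr (- _).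
rewrite /mxtrace coef_sum; apply: eq_bigr => i _.
rewrite !mxE coef_sum; apply: eq_bigr => k _.
by rewrite -coef_adj_revdet !mxE coefMC.
Qed.

(** Strong induction: differentiating [revdet_conv] expresses D h_(p+1) through lower terms, and
    [mxconvM] at m = 0, where Phi_0 = 1, gives B_p the matching recursion. *)
Lemma der_coef_inv_revdet p : D (h p.+1) = \tr (B p *m map_mx D A).
Proof.
have h0 : D (h 0) = 0 by rewrite /inv_coef big_ord1 expr0 coef1; exact: der1.
elim/ltn_ind: p => p IHp.
have := congr1 D (revdet_conv p); rewrite der0 // big_ord_recl subn0 coef0_revdet mul1r.
rewrite der_add // der_sum // => /(canRL (addrK _)) ->; rewrite sub0r.
have -> : B p = \sum_(l < p.+1) h (p - l)%N *: Phi l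
                - \sum_(l < p) a l.+1 *: B (p - l.+1).
  have := mxconvM A (fun q => g`_q) h 0 p.
  by rewrite mxconv0 coef0_revdet scale1r -mulmxE mul1mx.
rewrite mulmxBl raddfB /= !mxtrace_lincomb.
under eq_bigr => i _ do rewrite /= /bump add1n subSS (der_mul derD) der_coef_revdet.
rewrite big_split opprD /= -sumrN; congr (_ + _).
  by apply: eq_bigr => i _; ring.
rewrite big_ord_recr /= subnn h0 mulr0 addr0; congr (- _).
apply: eq_bigr => i _; rewrite -[(p - i)%N]prednK ?subn_gt0 // IHp -?subnS //.
by rewrite ltn_subrL (leq_ltn_trans _ (ltn_ord i)).
Qed.

(** The sum is the factor of zeta_j in [ccoef_t] at index m + 1. The product rule yields the two
    sums of [mxconvM], which merge into one product. *)
Lemma der_conv_revdet m j :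
  D (\sum_(l < j.+1) h (j - l) * a (m.+1 + l)) = - \tr (Phi m *m B j *m map_mx D A).
Proof.
have h0 : D (h 0) = 0 by rewrite /inv_coef big_ord1 expr0 coef1; exact: der1.
rewrite [Phi m *m B j](mxconvM A (fun q => g`_q) h m j) mulmxBl raddfB /= !mxtrace_lincomb opprB der_sum //.
under eq_bigr => i _ do rewrite (der_mul derD) addSn der_coef_revdet mulrN.
rewrite big_split sumrN /=; congr (_ - _).
rewrite big_ord_recr /= subnn h0 mul0r addr0.
apply: eq_bigr => i _; rewrite mulrC.
by rewrite -[(j - i)%N]prednK ?subn_gt0 // der_coef_inv_revdet -subnS.
Qed.

Lemma der_mxconvS m :
  map_mx D (Phi m.+1) =
  map_mx D A *m Phi m + A *m map_mx D (Phi m) - \tr (Phi m *m map_mx D A) *: 1%:M.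
Proof.
rewrite mxconvS -mulmxE der_addmx // der_mulmx // der_scalemx // der_mx1 //.
by rewrite scaler0 addr0 der_coef_revdet scaleNr.
Qed.

Lemma der_mxconvSr m :
  map_mx D (Phi m.+1) =
  map_mx D (Phi m) *m A + Phi m *m map_mx D A - \tr (Phi m *m map_mx D A) *: 1%:M.
Proof.
rewrite mxconvSr -mulmxE der_addmx // der_mulmx // der_scalemx // der_mx1 //.
by rewrite scaler0 addr0 der_coef_revdet scaleNr.
Qed.

Lemma der_mxconv0 : map_mx D (Phi 0) = 0.
Proof. by rewrite mxconv0 coef0_revdet scale1r der_mx1. Qed.

Lemma mxtrace_rank1 (N : 'M[R]_n) (u : 'cV_n) (v : 'rV_n) :
  \tr (N *m (u *m v)) = (v *m N *m u) 0 0.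
Proof. by rewrite mulmxA mxtrace_mulC mulmxA trace_mx11. Qed.

(* Replacing A by A + s u v only rescales (1 - tA)^-1 u, and this scalar cancels the
   change of the determinant: adj(1 - tA) u does not depend on s. *)
Lemma der_mxconv_rank1l (u : 'cV_n) (v : 'rV_n) m :
  map_mx D A = u *m v -> map_mx D (Phi m) *m u = 0.
Proof.
move=> DA; elim: m => [|m IHm]; first by rewrite der_mxconv0 mul0mx.
rewrite der_mxconvS mulmxBl mulmxDl -(mulmxA A) IHm mulmx0 addr0 DA mxtrace_rank1.
by rewrite -scalemxAl mul1mx -mul_mx_scalar -mx11_scalar !mulmxA subrr.
Qed.

Lemma der_mxconv_rank1r (u : 'cV_n) (v : 'rV_n) m :
  map_mx D A = u *m v -> v *m map_mx D (Phi m) = 0.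
Proof.
move=> DA; elim: m => [|m IHm]; first by rewrite der_mxconv0 mulmx0.
rewrite der_mxconvSr mulmxBr mulmxDr (mulmxA v) IHm mul0mx add0r DA mxtrace_rank1.
by rewrite -scalemxAr mulmx1 -mul_scalar_mx -mx11_scalar !mulmxA subrr.
Qed.

Lemma mxtrace_commutator (N E : 'M[R]_n) :
  N *m A = A *m N -> \tr (N *m (E *m A - A *m E)) = 0.
Proof.
move=> cNA; rewrite mulmxBr raddfB /= !mulmxA mxtrace_mulC mulmxA -cNA.
by rewrite subrr.
Qed.

(** Infinitesimal conjugation: Phi_m is a polynomial in A with conjugation-invariant coefficients,
    so the trace term of the recursion vanishes. *)
Lemma der_mxconv_commutator (E : 'M[R]_n) m :
  map_mx D A = E *m A - A *m E -> map_mx D (Phi m) = E *m Phi m - Phi m *m E.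
Proof.
move=> DA; elim: m => [|m IHm].
  by rewrite der_mxconv0 mxconv0 coef0_revdet scale1r mulmx1 mul1mx subrr.
have cA : Phi m *m A = A *m Phi m by exact: mxconv_comm.
rewrite der_mxconvS IHm DA mxtrace_commutator // scale0r subr0 mxconvS -mulmxE.
rewrite mulmxBl mulmxBr mulmxDr mulmxDl -scalemxAr -scalemxAl mulmx1 mul1mx !mulmxA.
by rewrite addrA subrK [in RHS]opprD [in RHS]addrACA subrr addr0.
Qed.

End RevDet.

(** * The three kinds of variables, and sums of Kronecker deltas *)

Section Index.
Variable n : nat.
Implicit Types i j k l : 'I_n.

Lemma eq_idxEE i j k l : (idxE i j == idxE k l) = (i == k) && (j == l).
Proof.
rewrite !(inj_eq (@lshift_inj _ _)) /mxvec_index (inj_eq (@cast_ord_inj _ _ _)).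
by rewrite (inj_eq enum_rank_inj).
Qed.
Lemma eq_idxYY i j : (idxY i == idxY j) = (i == j).
Proof. by rewrite (inj_eq (@lshift_inj _ _)) (inj_eq (@rshift_inj _ _)). Qed.
Lemma eq_idxXX i j : (idxX i == idxX j) = (i == j).
Proof. by rewrite (inj_eq (@rshift_inj _ _)). Qed.
Lemma eq_idxEY i j k : (idxE i j == idxY k) = false.
Proof. by rewrite (inj_eq (@lshift_inj _ _)) eq_lrshift. Qed.
Lemma eq_idxYE i j k : (idxY k == idxE i j) = false.
Proof. by rewrite eq_sym eq_idxEY. Qed.
Lemma eq_idxEX i j k : (idxE i j == idxX k) = false.
Proof. by rewrite eq_lrshift. Qed.
Lemma eq_idxXE i j k : (idxX k == idxE i j) = false.
Proof. by rewrite eq_rlshift. Qed.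
Lemma eq_idxYX i j : (idxY i == idxX j) = false.
Proof. by rewrite eq_lrshift. Qed.
Lemma eq_idxXY i j : (idxX i == idxY j) = false.
Proof. by rewrite eq_rlshift. Qed.

Definition eq_idx := (eq_idxEE, eq_idxYY, eq_idxXX, eq_idxEY, eq_idxYE,
  eq_idxEX, eq_idxXE, eq_idxYX, eq_idxXY).

Variant nvars_spec : 'I_(nvars n) -> Prop :=
  | NvarsE i j : nvars_spec (idxE i j)
  | NvarsY i : nvars_spec (idxY i)
  | NvarsX i : nvars_spec (idxX i).

Lemma nvarsP v : nvars_spec v.
Proof.
case: (split_ordP v) => [u ->|i ->]; last exact: NvarsX.
case: (split_ordP u) => [w ->|i ->]; last exact: NvarsY.
by case/mxvec_indexP: w => i j; exact: NvarsE.
Qed.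

End Index.

Lemma mderiv_var (K : nzRingType) m (u v : 'I_m) :
  mderiv u ('X_v : {mpoly K[m]}) = (v == u)%:R.
Proof.
rewrite mderivX mnm1E; case: eqP => [->|_]; last by rewrite scale0r.
rewrite scale1r (_ : (_ - _)%MM = 0%MM) ?mpolyX0 //.
by apply/mnmP => i; rewrite mnmBE mnm0E subnn.
Qed.

Lemma derivation_mderiv (K : comNzRingType) m (u : 'I_m) :
  derivation (@mderiv m K u).
Proof. by split=> f g; rewrite (mderivD, mderivM). Qed.

Section BigDelta.
Variables (R : pzSemiRingType) (I : finType).

Lemma sum_deltal (k : I) (F : I -> R) : \sum_i (i == k)%:R * F i = F k.
Proof.
rewrite (bigD1 k) //= eqxx mul1r big1 ?addr0 // => i /negPf ->.
by rewrite mul0r.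
Qed.

Lemma sum_deltar (k : I) (F : I -> R) : \sum_i F i * (i == k)%:R = F k.
Proof.
rewrite (bigD1 k) //= eqxx mulr1 big1 ?addr0 // => i /negPf ->.
by rewrite mulr0.
Qed.

Lemma exchange_big4 (F : I -> I -> I -> I -> R) :
  \sum_i \sum_j \sum_k \sum_l F i j k l = \sum_k \sum_l \sum_i \sum_j F i j k l.
Proof.
transitivity (\sum_(p : I * I) \sum_(q : I * I) F p.1 p.2 q.1 q.2).
  rewrite pair_bigA /=; apply: eq_bigr => p _; exact: pair_bigA.
rewrite exchange_big [RHS]pair_bigA /=; apply: eq_bigr => q _.
by rewrite pair_bigA.
Qed.

End BigDelta.

(** * Hamiltonian vector fields of the generators *)

Section Bracket.
Variables (K : fieldType) (n : nat) (zeta : {poly K}).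
Local Notation H := (HH K n).
Local Notation d a f := (mderiv a f).
Implicit Types f g : H.

(* adE k l, adY k and adX k are the derivations {-, e_kl}, {-, y_k} and {-, x_k}. *)
Definition adE (k l : 'I_n) f : H :=
  \sum_i d (idxE i k) f * eX K i l - \sum_j d (idxE l j) f * eX K k j
  - d (idxY l) f * yX K k + d (idxX k) f * xX K l.

Definition adY (k : 'I_n) f : H :=
  \sum_i d (idxE i k) f * yX K i - \sum_l d (idxX l) f * brYX zeta k l.

Definition adX (k : 'I_n) f : H :=
  \sum_i d (idxY i) f * brYX zeta i k - \sum_j d (idxE k j) f * xX K j.

(** Groups the bracket by partial derivatives of the second argument: the deltas collapse sums, and
    each mixed term feeds two of the vector fields. *)
Lemma pb_expand f g :
  pb zeta f g = \sum_k \sum_l d (idxE k l) g * adE k l f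
    + \sum_k d (idxY k) g * adY k f + \sum_k d (idxX k) g * adX k f.
Proof.
rewrite /pb exchange_big4.
have T2 : \sum_i \sum_j \sum_k
    (d (idxE i j) f * d (idxY k) g - d (idxY k) f * d (idxE i j) g) *
       ((j == k)%:R * yX K i)
  = \sum_k d (idxY k) g * (\sum_i d (idxE i k) f * yX K i)
    - \sum_i \sum_j d (idxE i j) g * (d (idxY j) f * yX K i).
  under [X in _ = X - _]eq_bigr do rewrite mulr_sumr.
  rewrite [X in _ = X - _]exchange_big -sumrB; apply: eq_bigr => i _.
  rewrite -sumrB; apply: eq_bigr => j _.
  under eq_bigr => k _ do rewrite mulrCA [j == k]eq_sym.
  by rewrite sum_deltal; ring.
have T3 : \sum_i \sum_j \sum_k
    (d (idxE i j) f * d (idxX k) g - d (idxX k) f * d (idxE i j) g) *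
       (- ((i == k)%:R * xX K j))
  = \sum_i \sum_j d (idxE i j) g * (d (idxX i) f * xX K j)
    - \sum_k d (idxX k) g * (\sum_j d (idxE k j) f * xX K j).
  under [X in _ = _ - X]eq_bigr do rewrite mulr_sumr.
  rewrite -sumrB; apply: eq_bigr => i _.
  rewrite -sumrB; apply: eq_bigr => j _.
  under eq_bigr => k _ do rewrite mulrN mulrCA [i == k]eq_sym.
  by rewrite sumrN sum_deltal; ring.
have T4 : \sum_i \sum_l
   (d (idxY i) f * d (idxX l) g - d (idxX l) f * d (idxY i) g) * brYX zeta i l
  = \sum_l d (idxX l) g * (\sum_i d (idxY i) f * brYX zeta i l)
    - \sum_i d (idxY i) g * (\sum_l d (idxX l) f * brYX zeta i l).
  under [X in _ = X - _]eq_bigr do rewrite mulr_sumr.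
  under [X in _ = _ - X]eq_bigr do rewrite mulr_sumr.
  rewrite [X in _ = X - _]exchange_big -sumrB; apply: eq_bigr => i _.
  by rewrite -sumrB; apply: eq_bigr => l _; ring.
have T1 : \sum_k \sum_l \sum_i \sum_j d (idxE i j) f * d (idxE k l) g *
       ((j == k)%:R * eX K i l - (l == i)%:R * eX K k j)
  = \sum_k \sum_l d (idxE k l) g *
     (\sum_i d (idxE i k) f * eX K i l - \sum_j d (idxE l j) f * eX K k j).
  apply: eq_bigr => k _; apply: eq_bigr => l _.
  under eq_bigr => i _.
    under eq_bigr => j _ do rewrite mulrBr mulrCA [X in _ - X]mulrCA [l == i]eq_sym.
    rewrite sumrB sum_deltal -mulr_sumr; over.
  rewrite sumrB sum_deltal mulrBr !mulr_sumr.
  by congr (_ - _); apply: eq_bigr => i _; ring.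
rewrite T1 T2 T3 T4.
have -> : \sum_k \sum_l d (idxE k l) g * adE k l f =
  \sum_k \sum_l d (idxE k l) g *
     (\sum_i d (idxE i k) f * eX K i l - \sum_j d (idxE l j) f * eX K k j)
  - \sum_k \sum_l d (idxE k l) g * (d (idxY l) f * yX K k)
  + \sum_k \sum_l d (idxE k l) g * (d (idxX k) f * xX K l).
  rewrite -sumrB -big_split; apply: eq_bigr => k _.
  rewrite -sumrB -big_split; apply: eq_bigr => l _ /=.
  by rewrite /adE; ring.
under [X in _ = _ + X + _]eq_bigr do rewrite mulrBr.
under [X in _ = _ + X]eq_bigr do rewrite mulrBr.
rewrite !sumrB.
by rewrite !addrA; ring.
Qed.

Lemma pb_y f k : pb zeta f (yX K k) = adY k f.
Proof.
rewrite pb_expand.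
under eq_bigr => i _ do under eq_bigr => j _ do rewrite mderiv_var eq_idx mul0r.
under [X in _ + X + _]eq_bigr => i _ do rewrite mderiv_var eq_idx eq_sym.
under [X in _ + X]eq_bigr => i _ do rewrite mderiv_var eq_idx mul0r.
by rewrite sum_deltal; under eq_bigr do rewrite big1_eq; rewrite !big1_eq addr0 add0r.
Qed.

Lemma poisson_centralP f :
  poisson_central zeta f <->
  [/\ forall k l, adE k l f = 0, forall k, adY k f = 0 & forall k, adX k f = 0].
Proof.
split=> [cf|[fE fY fX] g]; last first.
  rewrite pb_expand big1 => [|k _]; last by apply: big1 => l _; rewrite fE mulr0.
  by rewrite add0r !big1 ?addr0 // => k _; rewrite (fY, fX) mulr0.
split=> [k l|k|k]; last 1 first.
- have := cf (xX K k); rewrite pb_expand.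
  under eq_bigr => i _ do under eq_bigr => j _ do rewrite mderiv_var eq_idx mul0r.
  under [X in _ + X + _]eq_bigr => i _ do rewrite mderiv_var eq_idx mul0r.
  under [X in _ + X]eq_bigr => i _ do rewrite mderiv_var eq_idx eq_sym.
  by rewrite sum_deltal; under eq_bigr do rewrite big1_eq; rewrite !big1_eq !add0r.
- have := cf (eX K k l); rewrite pb_expand.
  under eq_bigr => i _.
    under eq_bigr => j _ do rewrite mderiv_var eq_idx -mulnb natrM -mulrA [l == j]eq_sym.
    rewrite -mulr_sumr sum_deltal eq_sym; over.
  under [X in _ + X + _]eq_bigr => i _ do rewrite mderiv_var eq_idx mul0r.
  under [X in _ + X]eq_bigr => i _ do rewrite mderiv_var eq_idx mul0r.
  by rewrite sum_deltal !big1_eq !addr0.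
- by rewrite -pb_y cf.
Qed.

Lemma derivation_adE k l : derivation (adE k l).
Proof.
have dm u : derivation (@mderiv (nvars n) K u) by exact: derivation_mderiv.
apply: derivation_add; last exact: derivation_scale.
apply: derivation_add; last by apply: derivation_opp; exact: derivation_scale.
apply: derivation_add; last apply: derivation_opp;
  by apply: derivation_sum => i; exact: derivation_scale.
Qed.

Lemma derivation_adY k : derivation (adY k).
Proof.
have dm u : derivation (@mderiv (nvars n) K u) by exact: derivation_mderiv.
apply: derivation_add; last apply: derivation_opp;
  by apply: derivation_sum => i; exact: derivation_scale.
Qed.

Lemma derivation_adX k : derivation (adX k).
Proof.
have dm u : derivation (@mderiv (nvars n) K u) by exact: derivation_mderiv.
apply: derivation_add; last apply: derivation_opp;
  by apply: derivation_sum => i; exact: derivation_scale.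
Qed.

End Bracket.

(** * Centrality of the proposed generators *)

Section Central.
Variables (K : fieldType) (n : nat) (zeta : {poly K}).
Local Notation H := (HH K n).
Local Notation A := (Amat K n).
Local Notation Phi := (mxconv A (fun q => (detp K n)`_q)).
Local Notation B := (mxconv A (hcoef K n)).

Implicit Types i j k l a b : 'I_n.

Definition ymx : 'rV[H]_n := \row_i yX K i.
Definition xmx : 'cV[H]_n := \col_i xX K i.
Definition bmx : 'M[H]_n := \sum_(j < size zeta) (zeta`_j)%:MP *: B j.

Lemma bmxE i l : bmx l i = brYX zeta i l.
Proof.
rewrite /bmx /brYX summxE; apply: eq_bigr => j _; rewrite mxE; congr (_ * _).
by rewrite /mxconv summxE; apply: eq_bigr => m _; rewrite mxE mulrC.
Qed.

Lemma bmx_comm M : A *m M = M *m A -> bmx *m M = M *m bmx.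
Proof.
move=> cAM; rewrite /bmx mulmx_sumr mulmx_suml; apply: eq_bigr => j _.
by rewrite -scalemxAr -scalemxAl; congr (_ *: _); exact: mxconv_comm.
Qed.

Lemma mxconv_bmx_comm m : Phi m *m bmx = bmx *m Phi m.
Proof. by apply/esym/bmx_comm/esym; exact: mxconv_comm. Qed.

(** Killing constants lets [D] pass through the coefficients of [zeta]. *)
Definition Kderivation (D : H -> H) := derivation D /\ forall c : K, D c%:MP = 0.

Lemma Kderivation_adE k l : Kderivation (@adE K n k l).
Proof.
split=> [|c]; first exact: derivation_adE.
rewrite /adE !mderivC !mul0r subr0 addr0.
by rewrite !big1 ?subrr // => i _; rewrite mderivC mul0r.
Qed.

Lemma Kderivation_adY k : Kderivation (adY zeta k : H -> H).
Proof.
split=> [|c]; first exact: derivation_adY.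
by rewrite /adY !big1 ?subrr // => i _; rewrite mderivC mul0r.
Qed.

Lemma Kderivation_adX k : Kderivation (adX zeta k : H -> H).
Proof.
split=> [|c]; first exact: derivation_adX.
by rewrite /adX !big1 ?subrr // => i _; rewrite mderivC mul0r.
Qed.

Lemma delta_mulmxE p k l (M : 'M[H]_(n, p)) a (b : 'I_p) :
  (delta_mx k l *m M) a b = (a == k)%:R * M l b.
Proof.
rewrite mxE; under eq_bigr => i _ do rewrite mxE -mulnb natrM -mulrA.
by rewrite -mulr_sumr sum_deltal.
Qed.

Lemma mulmx_deltaE p q k (l : 'I_q) (M : 'M[H]_(p, n)) (a : 'I_p) (b : 'I_q) :
  (M *m delta_mx k l) a b = (b == l)%:R * M a k.
Proof.
rewrite mxE; under eq_bigr => i _ do rewrite mxE -mulnb natrM mulrC -mulrA.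
by rewrite sum_deltal.
Qed.

(** The reversed indices match [Amat], whose (a, b) entry is [eX K b a]. *)
Lemma adE_eX k l a b :
  adE k l (eX K b a) = (a == k)%:R * eX K b l - (b == l)%:R * eX K k a.
Proof.
rewrite /adE !mderiv_var !eq_idx !mul0r subr0 addr0; congr (_ - _).
  under eq_bigr => i _ do rewrite mderiv_var eq_idx -mulnb natrM -mulrA eq_sym.
  by rewrite sum_deltal.
under eq_bigr => i _ do
  rewrite mderiv_var eq_idx -mulnb natrM -mulrA [a == i]eq_sym.
by rewrite -mulr_sumr sum_deltal.
Qed.

Lemma adE_yX k l i : adE k l (yX K i) = - ((i == l)%:R * yX K k).
Proof.
rewrite /adE !mderiv_var !eq_idx mul0r addr0.
by rewrite !big1 ?subrr ?sub0r // => j _; rewrite mderiv_var eq_idx mul0r.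
Qed.

Lemma adE_xX k l i : adE k l (xX K i) = (i == k)%:R * xX K l.
Proof.
rewrite /adE !mderiv_var !eq_idx mul0r.
by rewrite !big1 ?subr0 ?add0r // => j _; rewrite mderiv_var eq_idx mul0r.
Qed.

Lemma adY_eX k a b : adY zeta k (eX K b a) = (a == k)%:R * yX K b.
Proof.
rewrite /adY; under eq_bigr => i _ do
  rewrite mderiv_var eq_idx -mulnb natrM -mulrA eq_sym.
rewrite sum_deltal big1 ?subr0 // => i _.
by rewrite mderiv_var eq_idx mul0r.
Qed.

Lemma adY_yX k i : adY zeta k (yX K i) = 0.
Proof.
by rewrite /adY !big1 ?subrr // => j _; rewrite mderiv_var eq_idx mul0r.
Qed.

Lemma adY_xX k i : adY zeta k (xX K i) = - brYX zeta k i.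
Proof.
rewrite /adY big1 => [|j _]; last by rewrite mderiv_var eq_idx mul0r.
under eq_bigr => j _ do rewrite mderiv_var eq_idx eq_sym.
by rewrite sum_deltal sub0r.
Qed.

Lemma adX_eX k a b : adX zeta k (eX K b a) = - ((b == k)%:R * xX K a).
Proof.
rewrite /adX big1 => [|j _]; last by rewrite mderiv_var eq_idx mul0r.
under eq_bigr => i _ do
  rewrite mderiv_var eq_idx -mulnb natrM -mulrA [a == i]eq_sym.
by rewrite -mulr_sumr sum_deltal sub0r.
Qed.

Lemma adX_yX k i : adX zeta k (yX K i) = brYX zeta i k.
Proof.
rewrite /adX; under eq_bigr => j _ do rewrite mderiv_var eq_idx eq_sym.
rewrite sum_deltal big1 ?subr0 // => j _.
by rewrite mderiv_var eq_idx mul0r.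
Qed.

Lemma adX_xX k i : adX zeta k (xX K i) = 0.
Proof.
by rewrite /adX !big1 ?subrr // => j _; rewrite mderiv_var eq_idx mul0r.
Qed.

Lemma adE_Amat k l : map_mx (adE k l) A = delta_mx k l *m A - A *m delta_mx k l.
Proof.
apply/matrixP => a b; rewrite [in RHS]mxE [X in _ = _ + X]mxE.
by rewrite delta_mulmxE mulmx_deltaE !mxE adE_eX.
Qed.

Lemma adE_ymx k l : map_mx (adE k l) ymx = - (ymx *m delta_mx k l).
Proof.
by apply/matrixP => a b; rewrite [in RHS]mxE mulmx_deltaE !mxE adE_yX.
Qed.

Lemma adE_xmx k l : map_mx (adE k l) xmx = delta_mx k l *m xmx.
Proof.
by apply/matrixP => a b; rewrite delta_mulmxE !mxE adE_xX.
Qed.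

Lemma adY_Amat k : map_mx (adY zeta k) A = delta_mx k 0 *m ymx.
Proof.
by apply/matrixP => a b; rewrite !mxE big_ord1 !mxE adY_eX eqxx andbT.
Qed.

Lemma adY_ymx k : map_mx (adY zeta k) ymx = 0.
Proof. by apply/matrixP => a b; rewrite !mxE adY_yX. Qed.

Lemma adY_xmx k : map_mx (adY zeta k) xmx = - (bmx *m delta_mx k 0).
Proof.
apply/matrixP => a b; rewrite [in RHS]mxE mulmx_deltaE !mxE adY_xX bmxE.
by rewrite ord1 eqxx mul1r.
Qed.

Lemma adX_Amat k : map_mx (adX zeta k) A = xmx *m (- delta_mx 0 k).
Proof.
apply/matrixP => a b; rewrite !mxE big_ord1 !mxE adX_eX eqxx /=.
by rewrite mulrN mulrC.
Qed.

Lemma adX_xmx k : map_mx (adX zeta k) xmx = 0.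
Proof. by apply/matrixP => a b; rewrite !mxE adX_xX. Qed.

Lemma adX_ymx k : map_mx (adX zeta k) ymx = delta_mx 0 k *m bmx.
Proof.
apply/matrixP => a b; rewrite [LHS]mxE [ymx _ _]mxE adX_yX [RHS]mxE -bmxE ord1.
under eq_bigr => i _ do rewrite mxE eqxx.
by rewrite sum_deltal.
Qed.

(** The derivative of A along y_i has rank one, so its trace against Phi_m is coordinate i of y
    Phi_m; the minus sign of [der_coef_revdet] turns (-1)^(m+1) into (-1)^m. *)
Lemma tauk_mxconv m : tauk n zeta m.+1 = (-1) ^+ m * (ymx *m Phi m *m xmx) 0 0.
Proof.
rewrite /tauk mxE mulr_sumr; apply: eq_bigr => i _.
rewrite pb_y /Qk (der_mul (derivation_adY zeta i)) (der_signr (derivation_adY zeta i)).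
rewrite mul0r add0r.
rewrite (der_coef_revdet A (derivation_adY zeta i)) adY_Amat mxtrace_rank1.
rewrite -colE [col _ _ _ _]mxE [xmx _ _]mxE. rewrite exprS mulN1r; ring.
Qed.

Lemma centerGenE (i : 'I_n) :
  centerGen zeta i
  = (-1) ^+ i * ((ymx *m Phi i *m xmx) 0 0 - ccoef_t n zeta i.+1).
Proof. by rewrite /centerGen tauk_mxconv /ck exprS mulN1r mulNr -mulrBr. Qed.

Lemma der_ccoef_t (D : H -> H) m : Kderivation D ->
  D (ccoef_t n zeta m.+1) = - \tr (Phi m *m bmx *m map_mx D A).
Proof.
case=> dD DC; rewrite /ccoef_t (der_sum dD) /bmx mulmx_sumr.
rewrite mulmx_suml [X in - X]raddf_sum /= -sumrN; apply: eq_bigr => j _.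
rewrite (der_mul dD) DC mul0r add0r (der_conv_revdet A dD).
by rewrite -scalemxAr -scalemxAl /= mxtraceZ mulrN.
Qed.

(** The product rule for y Phi_i x; the trace is the contribution of -c(t)_(i+1), and the common
    sign is a constant. *)
Lemma der_centerGen (D : H -> H) (i : 'I_n) : Kderivation D ->
  map_mx D ymx *m Phi i *m xmx + ymx *m map_mx D (Phi i) *m xmx
    + ymx *m Phi i *m map_mx D xmx
    + (\tr (Phi i *m bmx *m map_mx D A))%:M = 0 ->
  D (centerGen zeta i) = 0.
Proof.
move=> KD; have dD := KD.1 => E.
rewrite centerGenE (der_mul dD) (der_signr dD) mul0r add0r (der_sub dD).
rewrite der_ccoef_t // opprK.
have -> : D ((ymx *m Phi i *m xmx) 0 0) = map_mx D (ymx *m Phi i *m xmx) 0 0.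
  by rewrite [RHS]mxE.
rewrite !(der_mulmx dD) mulmxDl.
have /matrixP/(_ 0 0) := E; rewrite 4!mxE [X in _ + X = _]mxE mulr1n [RHS]mxE.
by move=> ->; rewrite mulr0.
Qed.

Lemma centerGen_central i : poisson_central zeta (centerGen zeta i).
Proof.
apply/poisson_centralP; split=> [k l|k|k]; apply: der_centerGen.
- exact: Kderivation_adE.
(* The commutator from Phi_i cancels the terms from y and x; the trace vanishes because Phi_i b
   commutes with A. *)
- rewrite adE_Amat adE_ymx adE_xmx (der_mxconv_commutator (derivation_adE _ k l) _ (adE_Amat k l)).
  rewrite mxtrace_commutator ?raddf0.
    rewrite -[revdet A]/(detp K n) mulmxBr mulmxBl !mulmxA !mulNmx addr0 addrA.
    by rewrite addNr sub0r addNr.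
  have cA : Phi i *m A = A *m Phi i by exact: mxconv_comm.
  have bA : bmx *m A = A *m bmx by exact: bmx_comm.
  by rewrite -mulmxA bA [RHS]mulmxA -cA [LHS]mulmxA.
- exact: Kderivation_adY.
(* The term with the derivative of Phi_i vanishes; the derivative of x contributes -y Phi_i b e_k,
   opposite to the trace. *)
- rewrite adY_Amat adY_ymx adY_xmx mxtrace_rank1 -mx11_scalar.
  rewrite (der_mxconv_rank1r (derivation_adY zeta k) i (adY_Amat k)).
  by rewrite !mul0mx !add0r mulmxN !mulmxA addNr.
- exact: Kderivation_adX.
(* The derivative of y contributes row k of b Phi_i x and the trace minus row k of Phi_i b x; these
   cancel as b and Phi_i commute. *)
- rewrite adX_Amat adX_ymx adX_xmx mxtrace_rank1 -mx11_scalar -(mulmxA ymx).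
  rewrite (der_mxconv_rank1l (derivation_adX zeta k) i (adX_Amat k)).
  by rewrite !mulmx0 !addr0 !mulNmx mxconv_bmx_comm !mulmxA subrr.
Qed.

End Central.

(** Reduces identities between ring morphisms and derivations to constants and variables. *)
Lemma mpoly_alg_ind (K : nzRingType) m (P : {mpoly K[m]} -> Prop) :
  (forall c, P c%:MP) -> (forall v, P 'X_v) ->
  (forall f g, P f -> P g -> P (f + g)) -> (forall f g, P f -> P g -> P (f * g)) ->
  forall f, P f.
Proof.
move=> PC PX PD PM; elim/mpolyind => [|c u p _ _ Pp]; first by rewrite -mpolyC0.
apply: (PD) => //; rewrite -mul_mpolyC; apply: (PM) => //.
rewrite mpolyXE_id; apply: (big_ind P) => [||v _]; rewrite -?mpolyC1 //.
by elim: (u v) => [|k IHk]; rewrite ?expr0 -?mpolyC1 // exprS; apply: PM.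
Qed.

(** * Restriction to the slice *)

Section Slice.
Variables (K : fieldType) (n : nat) (zeta : {poly K}).
Local Notation H := (HH K n).
Local Notation S := {mpoly K[n]}.
Local Notation d a f := (mderiv a f).

Implicit Types f g : H.

(* Restriction to A = N with N_(j+1, j) = 1, x = e_0, y_i = (-1)^i X_i. *)
Definition slice_var (v : 'I_(nvars n)) : S :=
  match split v with
  | inl u =>
      match split u with
      | inl w => let: (j, i) := enum_val (cast_ord (esym (mxvec_cast n n)) w) in
                 (val i == (val j).+1)%:R
      | inr i => (-1) ^+ i * 'X_i
      end
  | inr i => (val i == 0%N)%:R
  end.

Definition slice : H -> S := mmap (@mpolyC n K) slice_var.

HB.instance Definition _ := GRing.RMorphism.on slice.

Lemma sliceC c : slice c%:MP = c%:MP. Proof. exact: mmapC. Qed.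

Lemma slice_eX i j : slice (eX K j i) = (val i == (val j).+1)%:R.
Proof.
rewrite /slice mmapX mmap1U /slice_var (unsplitK (inl _)) (unsplitK (inl _)).
by rewrite /mxvec_index cast_ordK enum_rankK.
Qed.
Lemma slice_yX i : slice (yX K i) = (-1) ^+ i * 'X_i.
Proof. by rewrite /slice mmapX mmap1U /slice_var (unsplitK (inl _)) (unsplitK (inr _)). Qed.
Lemma slice_xX i : slice (xX K i) = (val i == 0%N)%:R.
Proof. by rewrite /slice mmapX mmap1U /slice_var (unsplitK (inr _)). Qed.

(** Chain rule in the directions tangent to the slice, where y_i has slope (-1)^i in X_i. *)
Lemma mderiv_slice (i : 'I_n) f :
  d i (slice f) = (-1) ^+ i * slice (d (idxY i) f).
Proof.
have sgn k : d i ((-1) ^+ k : S) = 0 by exact: (der_signr (derivation_mderiv K i)).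
have nat k : d i (k%:R : S) = 0 by exact: (der_natr (derivation_mderiv K i)).
elim/mpoly_alg_ind: f => [c|v|f g IHf IHg|f g IHf IHg].
- by rewrite sliceC !mderivC rmorph0 mulr0.
- rewrite mderiv_var; case: (nvarsP v) => [k l|k|k]; rewrite eq_idx.
  + by rewrite [slice _](slice_eX l k) nat rmorph0 mulr0.
  + rewrite [slice _](slice_yX k) mderivM sgn mul0r add0r mderiv_var.
    by case: eqP => [->|_]; rewrite ?rmorph1 ?rmorph0 ?mulr0.
  + by rewrite [slice _](slice_xX k) nat rmorph0 mulr0.
- by rewrite rmorphD !mderivD rmorphD IHf IHg mulrDr.
- by rewrite rmorphM !mderivM rmorphD !rmorphM IHf IHg; ring.
Qed.

Lemma slice_mderivY (i : 'I_n) f : slice f = 0 -> slice (d (idxY i) f) = 0.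
Proof.
move=> f0; apply: (can_inj (signrMK i)).
by rewrite -mderiv_slice f0 raddf0 mulr0.
Qed.

(** * Vanishing to infinite order along the slice *)

Definition mderivs s f : H := foldl (fun g v => d v g) f s.

Lemma mderivs_add s f g : mderivs s (f + g) = mderivs s f + mderivs s g.
Proof. by elim: s f g => //= v s IHs f g; rewrite mderivD. Qed.

Lemma mderivs_comm s v f : mderivs s (d v f) = d v (mderivs s f).
Proof. by elim: s f => //= w s IHs f; rewrite mderiv_comm. Qed.

Lemma mderivs0 s : mderivs s 0 = 0.
Proof. by elim: s => //= v s; rewrite mderiv0. Qed.

Lemma mderivs_sum s I (r : seq I) (P : pred I) F :
  mderivs s (\sum_(i <- r | P i) F i) = \sum_(i <- r | P i) mderivs s (F i).
Proof. exact: (big_morph _ (mderivs_add s) (mderivs0 s)). Qed.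

Lemma mderivs_opp s f : mderivs s (- f) = - mderivs s f.
Proof. by elim: s f => //= v s IHs f; rewrite mderivN. Qed.

Definition vanish_below m f := forall s, (size s < m)%N -> slice (mderivs s f) = 0.

(** In the Leibniz expansion, every term that differentiates [c] takes fewer than [size s]
    derivatives of [f], hence vanishes on the slice. *)
Lemma slice_mderivsM s f c : vanish_below (size s) f ->
  slice (mderivs s (f * c)) = slice (mderivs s f) * slice c.
Proof.
elim: s f c => [|v s IHs] f c /= vf; first by rewrite rmorphM.
rewrite mderivM mderivs_add rmorphD /= !IHs; last first.
- by move=> t ltt; apply: vf; rewrite ltnS ltnW.
- by move=> t ltt; apply: (vf (v :: t)).
by rewrite (vf s) ?mul0r ?addr0.
Qed.

Lemma vanish_below_mderiv m v f : vanish_below m.+1 f -> vanish_below m (d v f).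
Proof. by move=> vf s lts; apply: (vf (v :: s)). Qed.

(* At a point (N, e_0, y) of the slice the vector fields {., e_kl}, {., x_k} and
   the directions y_i tangent to the slice span the whole tangent space; [M] and [u] are
   the A- and x-components of a covector killed by all of them. *)
Lemma slice_transversal (M : 'M[S]_n) (u : 'cV[S]_n) :
  (forall k (j : 'I_n), val j = 0%N -> M j k = 0) ->
  (forall k l : 'I_n, \sum_i M k i * (val l == (val i).+1)%:R
     - \sum_j M j l * (val j == (val k).+1)%:R + u k 0 * (val l == 0%N)%:R = 0) ->
  M = 0 /\ u = 0.
Proof.
move=> M0 R.
have sumS (F : 'I_n -> S) (k j : 'I_n) : val j = (val k).+1 ->
    \sum_i F i * (val i == (val k).+1)%:R = F j.
  move=> jk; rewrite -jk; under eq_bigr do rewrite (inj_eq val_inj); exact: sum_deltar.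
have sumP (F : 'I_n -> S) (l j : 'I_n) : val l = (val j).+1 ->
    \sum_i F i * (val l == (val i).+1)%:R = F j.
  move=> lj; under eq_bigr do rewrite lj eqSS eq_sym (inj_eq val_inj).
  exact: sum_deltar.
have sumT (F : 'I_n -> S) (k : 'I_n) : (val k).+1 = n ->
    \sum_i F i * (val i == (val k).+1)%:R = 0.
  move=> kn; apply: big1 => i _; rewrite kn.
  by rewrite (ltn_eqF (ltn_ord i)) mulr0.
have sum0 (F : 'I_n -> S) (l : 'I_n) : val l = 0%N ->
    \sum_i F i * (val l == (val i).+1)%:R = 0.
  by move=> l0; apply: big1 => i _; rewrite l0 mulr0.
(* The relation at (i, j + 1), outside the last row, makes M constant along diagonals. *)
have diag (i j i' j' : 'I_n) : val i' = (val i).+1 -> val j' = (val j).+1 ->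
    M i' j' = M i j.
  move=> ii jj; have := R i j'.
  rewrite (sumP _ _ _ jj) (sumS _ _ _ ii) jj mulr0 addr0.
  by move/eqP; rewrite subr_eq0 => /eqP.
(* On or above the main diagonal, every diagonal starts in row 0, where M vanishes. *)
have Mup (i j : 'I_n) : (i <= j)%N -> M i j = 0.
  case: i => i; elim: i j => [|i IHi] [[|j] ltj] lti leij //; try exact: M0.
  have lti' := ltnW lti; have ltj' := ltnW ltj.
  by rewrite (diag (Ordinal lti') (Ordinal ltj')) // IHi.
(* Below the main diagonal, descend to the last row: there the second sum of the relation is empty,
   which forces the entry to be 0. *)
have Mlow k (i j : 'I_n) : (n - i = k)%N -> (j < i)%N -> M i j = 0.
  elim: k i j => [|k IHk] i j nik ji.
    by move: (ltn_ord i); rewrite -subn_gt0 nik.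
  have ltj : (j.+1 < n)%N by apply: leq_ltn_trans ji (ltn_ord i).
  have [ltSi|] := ltnP i.+1 n.
    rewrite -(diag i j (Ordinal ltSi) (Ordinal ltj)) //; apply: IHk => //=.
    by rewrite subnS nik.
  move=> leni; have Sin : (val i).+1 = n by apply/eqP; rewrite eqn_leq leni ltn_ord.
  have := R i (Ordinal ltj).
  by rewrite (sumP _ _ j) // (sumT _ _ Sin) mulr0 addr0 subr0.
have MZ : M = 0.
  apply/matrixP => i j; rewrite mxE; have [/Mup //|/Mlow] := leqP i j; exact.
split=> //; apply/matrixP => k z; rewrite ord1 mxE.
have n0 : (0 < n)%N by apply: leq_ltn_trans (ltn_ord k).
(* Once M = 0, the relation at l = 0 leaves only u_k. *)
have := R k (Ordinal n0).
by rewrite MZ !big1 ?subrr ?add0r ?mulr1 // => i _; rewrite mxE mul0r.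
Qed.

Lemma central_vanish f : poisson_central zeta f -> slice f = 0 ->
  forall m, vanish_below m f.
Proof.
case/poisson_centralP=> fE _ fX f0; elim=> [//|m IHm] s.
rewrite ltnS leq_eqVlt => /orP[/eqP sm|]; last exact: IHm.
case: s sm => [|v s] //= sm; subst m.
have vs w : vanish_below (size s) (d w f) by exact: vanish_below_mderiv.
(* Letting [w] range over all variables in place of [v] gives the covector to which transversality
   is applied. *)
pose phi w := slice (mderivs s (d w f)).
(* The direction y_i is tangent to the slice, so it can be taken last, on a function that vanishes
   there by induction. *)
have phiY i : phi (idxY i) = 0.
  by rewrite /phi mderivs_comm; apply/slice_mderivY/IHm.
pose L g := slice (mderivs s g).
have LD g h : L (g + h) = L g + L h by rewrite /L mderivs_add rmorphD.
have LB g h : L (g - h) = L g - L h by rewrite LD /L mderivs_opp rmorphN.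
have Lsum (F : 'I_n -> H) : L (\sum_i F i) = \sum_i L (F i).
  by rewrite /L mderivs_sum rmorph_sum.
(* Only the values on the slice of the coefficients of a vector field survive. *)
have phiM w c : L (d w f * c) = phi w * slice c by exact: slice_mderivsM.
have LfX k : L (adX zeta k f) = 0 by rewrite /L fX mderivs0 rmorph0.
have LfE k l : L (adE k l f) = 0 by rewrite /L fE mderivs0 rmorph0.
have [||MZ uZ] := @slice_transversal (\matrix_(i, j) phi (idxE j i)) (\col_i phi (idxX i)).
(* Since x = e_0 and the y-terms vanish, {-, x_k} leaves only the derivative in e_kj with j = 0. *)
- move=> k j j0; rewrite mxE; have := LfX k.
  rewrite /adX LB !Lsum big1 => [|i _]; last by rewrite phiM phiY mul0r.
  under eq_bigr => i _ do rewrite phiM slice_xX -j0 (inj_eq val_inj).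
  by rewrite sum_deltar sub0r => /eqP; rewrite oppr_eq0 => /eqP.
- move=> k l; rewrite !mxE; have := LfE k l.
  rewrite /adE LD !LB !Lsum !phiM phiY mul0r subr0 slice_xX => E.
  rewrite -[RHS]E; congr (_ - _ + _); apply: eq_bigr => i _;
    by rewrite mxE phiM slice_eX.
case: (nvarsP v) => [i j|i|i]; [|exact: phiY|].
- by have /matrixP/(_ j i) := MZ; rewrite !mxE.
- by have /matrixP/(_ i 0) := uZ; rewrite !mxE.
Qed.

(** Induction on a degree bound: partial derivatives have smaller degree and inherit the vanishing,
    so they are zero and only a constant remains, which the slice detects. *)
Lemma vanish_eq0 f : [pchar K] =i pred0 -> (forall m, vanish_below m f) -> f = 0.
Proof.
move=> /pcharf0P ch0 vf.
have vf' v g : (forall m, vanish_below m g) -> forall m, vanish_below m (d v g).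
  by move=> vg m; apply: vanish_below_mderiv.
(* Characteristic 0 enters here: differentiation multiplies a coefficient by a nonzero exponent. *)
have const (g : H) : (forall v, d v g = 0) -> g = (g@_0)%:MP.
  move=> dg; apply/mpolyP => m; rewrite mcoeffC; case: eqP => [->|/eqP m0].
    by rewrite mulr1.
  have [v mv] : exists v, m v != 0%N.
    apply/existsP; apply: contraR m0 => /existsPn m0.
    by apply/eqP/mnmP => v; rewrite mnm0E; apply/eqP; rewrite -[_ == _]negbK.
  have Um : (U_(v) <= m)%MM.
    by apply/mnm_lepP => w; rewrite mnm1E; case: eqP => // <-; rewrite lt0n.
  have := mcoeff_deriv v (m - U_(v)) g; rewrite dg mcoeff0 submK //.
  by move/esym/eqP; rewrite mulr0 -[_ *+ _]mulr_natr mulf_eq0 ch0 orbF => /eqP.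
suff deg k : forall g : H, (forall m, vanish_below m g) ->
    (forall m, (k <= mdeg m)%N -> g@_m = 0) -> g = 0.
  by apply: (deg (msize f)) => // m /msize_mdeg_ge/memN_msupp_eq0.
elim: k => [|k IHk] g vg gk.
  by apply/mpolyP => m; rewrite gk // mcoeff0.
have dg v : d v g = 0.
  apply: IHk => [|m km]; first exact: vf'.
  by rewrite mcoeff_deriv gk ?mul0rn // mdegD mdeg1 addn1.
rewrite (const _ dg); have := vg 1%N [::] isT.
by rewrite /= (const _ dg) sliceC mcoeffC eqxx mulr1 => /eqP; rewrite mpolyC_eq0 => /eqP ->.
Qed.

(** * The generators on the slice *)

Local Notation A := (Amat K n).
Local Notation Phi := (mxconv A (fun q => (detp K n)`_q)).

(** The matrix 1 - tN is lower unitriangular. *)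
Lemma slice_detp q : slice (detp K n)`_q = (q == 0%N)%:R.
Proof.
rewrite -[slice _](coef_map slice) /detp -det_map_mx det_trig.
  rewrite big1 ?coef1 // => i _; rewrite !mxE eqxx rmorphB rmorphM rmorph1 /=.
  by rewrite map_polyC /= slice_eX (ltn_eqF (ltnSn _)) mulr0 subr0.
apply/is_trig_mxP => i j ltij; rewrite !mxE rmorphB rmorphM /= map_polyC /=.
rewrite slice_eX (ltn_eqF (leq_trans ltij (leqnSn _))) mulr0 subr0.
by rewrite -(inj_eq val_inj) (ltn_eqF ltij) rmorph0.
Qed.

(** On the slice Phi_q becomes N^q, and N^q e_0 = e_q. *)
Lemma slice_mxconv q i : slice ((Phi q *m xmx K n) i 0) = (val i == q)%:R.
Proof.
elim: q i => [|q IHq] i.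
  rewrite mxconv0 -scalemxAl mul1mx !mxE rmorphM /= slice_detp mul1r.
  exact: slice_xX.
rewrite mxconvS -mulmxE mulmxDl -mulmxA -scalemxAl mxE [X in _ + X]mxE.
rewrite rmorphD rmorphM /= slice_detp mul0r addr0 mxE rmorph_sum.
under eq_bigr => j _ do rewrite rmorphM /= IHq mxE slice_eX.
case: i => -[|i] lti /=; first by apply: big1 => j _; rewrite mul0r.
pose i' := Ordinal (ltnW lti).
under eq_bigr => j _ do
  rewrite -[(i.+1 == _)]/(val i' == val j) eq_sym (inj_eq val_inj).
by rewrite sum_deltal.
Qed.

(** The c-part involves only coefficients of det(1 - tA) of positive index, which vanish; the sign
    in [slice_var] cancels the one in [centerGenE]. *)
Lemma slice_centerGen (i : 'I_n) : slice (centerGen zeta i) = 'X_i.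
Proof.
rewrite centerGenE rmorphM rmorphB rmorph_sign -mulmxA mxE rmorph_sum /=.
under eq_bigr => j _ do
  rewrite rmorphM /= slice_mxconv (inj_eq val_inj) mxE slice_yX.
rewrite sum_deltar /ccoef_t rmorph_sum big1 ?subr0 ?signrMK // => j _.
rewrite rmorphM rmorph_sum big1 ?mulr0 // => l _.
by rewrite rmorphM /= slice_detp mulr0.
Qed.

(** This left inverse yields algebraic independence and recovers the polynomial behind a central
    element. *)
Lemma slice_evalGen P : slice (evalGen zeta P) = P.
Proof.
rewrite /evalGen; elim/mpoly_alg_ind: P => [c|i|f g IHf IHg|f g IHf IHg].
- by rewrite mmapC sliceC.
- by rewrite mmapX mmap1U slice_centerGen.
- by rewrite rmorphD rmorphD /= IHf IHg.
- by rewrite rmorphM rmorphM /= IHf IHg.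
Qed.

(** * The Poisson center as a subalgebra, and its description *)

Lemma poisson_centralC c : poisson_central zeta (c%:MP : H).
Proof.
apply/poisson_centralP; split=> [k l|k|k].
- exact: (Kderivation_adE _ k l).2.
- exact: (Kderivation_adY zeta k).2.
- exact: (Kderivation_adX zeta k).2.
Qed.

Lemma poisson_centralD f g :
  poisson_central zeta f -> poisson_central zeta g -> poisson_central zeta (f + g).
Proof.
move=> /poisson_centralP[fE fY fX] /poisson_centralP[gE gY gX].
apply/poisson_centralP; split=> [k l|k|k].
- by rewrite (der_add (derivation_adE _ k l)) fE gE addr0.
- by rewrite (der_add (derivation_adY _ k)) fY gY addr0.
- by rewrite (der_add (derivation_adX _ k)) fX gX addr0.
Qed.

Lemma poisson_centralM f g :
  poisson_central zeta f -> poisson_central zeta g -> poisson_central zeta (f * g).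
Proof.
move=> /poisson_centralP[fE fY fX] /poisson_centralP[gE gY gX].
apply/poisson_centralP; split=> [k l|k|k].
- by rewrite (der_mul (derivation_adE _ k l)) fE gE mul0r mulr0 addr0.
- by rewrite (der_mul (derivation_adY _ k)) fY gY mul0r mulr0 addr0.
- by rewrite (der_mul (derivation_adX _ k)) fX gX mul0r mulr0 addr0.
Qed.

Lemma evalGen_central (P : S) : poisson_central zeta (evalGen zeta P).
Proof.
rewrite /evalGen; elim/mpoly_alg_ind: P => [c|i|f g IHf IHg|f g IHf IHg].
- by rewrite mmapC; apply: poisson_centralC.
- by rewrite mmapX mmap1U; apply: centerGen_central.
- by rewrite rmorphD /=; exact: poisson_centralD IHf IHg.
- by rewrite rmorphM /=; exact: poisson_centralM IHf IHg.
Qed.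

Lemma poisson_center_evalGen f : [pchar K] =i pred0 ->
  poisson_central zeta f <-> exists P, f = evalGen zeta P.
Proof.
move=> ch0; split=> [cf|[P ->]]; last exact: evalGen_central.
(* By [slice_evalGen] this is the only possible witness, and the difference is then zero on the
   slice. *)
exists (slice f); apply/eqP; rewrite -subr_eq0; apply/eqP/vanish_eq0 => //.
apply: central_vanish; last by rewrite rmorphB /= slice_evalGen subrr.
apply: poisson_centralD => //; rewrite -mulN1r -mpolyC1 -mpolyCN.
by apply: poisson_centralM; [exact: poisson_centralC | exact: evalGen_central].
Qed.

End Slice.

Theorem theorem5p2 (R : realType) (n : nat) (zeta : {poly R[i]}) :
  (0 < n)%N ->
  (forall f : HH R[i] n,
     poisson_central zeta f <-> exists P : {mpoly R[i][n]}, f = evalGen zeta P)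
  /\ (forall P : {mpoly R[i][n]}, evalGen zeta P = 0 -> P = 0).
Proof.
move=> _; split=> [f|P P0]; first exact/poisson_center_evalGen/Num.Theory.pchar_num.
by rewrite -(slice_evalGen zeta P) P0 rmorph0.
Qed.
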